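(* Let $a,b\in\mathbb{N}^n$ with $a$ nonincreasing, $\max_i b_i\le n-1$, and $\sum_{i\le n}a_i=\sum_{i\le n}b_i$. For $k\in\{1,\dots,n\}$ let $(\mathrm{F}_k)$ denote the inequality $$\sum_{i\le k}a_i\le\sum_{i\le k}\min\{k-1,b_i\}+\sum_{i>k}\min\{k,b_i\}.$$ The following are equivalent: (1) $(a,b)$ is digraphic; (2) $a\trianglelefteq b^{0,I}$; (3) $(\mathrm{F}_k)$ holds for all $k\in\{1,\dots,n\}$; (4) $(\mathrm{F}_k)$ holds for all $k\in C(a)$ such that $k\le\max_i b_i$. If, further, $b$ is nonincreasing, then these are equivalent to (5) $j\,a'_j+\sum_{i>j}a'_i\le\Big(\sum_{i\le a'_j}b'_i\Big)-\min\{a'_j,\,b'_{a'_j}\}$ for all $j\in C(a')$ such that $a'_j\le\max_i b_i$.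
   Context: $\mathbb{N}=\{0,1,2,\dots\}$. The pair $(a,b)$ is digraphic if there exists a simple directed graph (no loops, no multiple edges; opposite edges $(u,v)$ and $(v,u)$ may both be present) on vertices $1,\dots,n$ such that vertex $i$ has $a_i$ outgoing edges and $b_i$ incoming edges. For $c\in\mathbb{N}^n$, the conjugate $c'=(c'_1,c'_2,\dots)$ is $c'_k=\#\{i:c_i\ge k\}$. For $x,y\in\mathbb{N}^n$, $x\trianglelefteq y$ means $\sum_{i\le k}x_i\le\sum_{i\le k}y_i$ for all $k\in\{1,\dots,n\}$. For matrices $A,B\in\mathbb{N}^{n\times n}$, $A\trianglelefteq B$ means that their vectors of column sums $\alpha,\beta$ satisfy $\alpha\trianglelefteq\beta$; if a finite set of such matrices has a unique maximal element with respect to $\trianglelefteq$, its generalized conjugate is the vector of column sums of this maximal element. $b^{0,I}\in\mathbb{N}^n$ is the generalized conjugate of the set of matrices in $\{0,1\}^{n\times n}$ with row sums $b$ and zeros on the diagonal; explicitly, $\sum_{i\le k}b^{0,I}_i=\sum_{i\le k}\min\{k-1,b_i\}+\sum_{i>k}\min\{k,b_i\}$. For nonincreasing $x\in\mathbb{N}^n$, the set of corners is $C(x)=\{k:1\le k\le n,\ x_k>x_{k+1}\}$ with the convention $x_{n+1}=0$; likewise $C(a')=\{j\ge1:a'_j>a'_{j+1}\}$. *)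

(* Defs.v *)
From mathcomp Require Import all_boot matrix.

Set Implicit Arguments.
Unset Strict Implicit.
Unset Printing Implicit Defensive.

(* Coordinates are numbered from 1; coordinates outside 1, ..., n are 0,
   which is the convention x_(n+1) = 0 used for corners. *)
Definition entry n (x : n.-tuple nat) (i : nat) : nat := nth 0 (0 :: x) i.

Definition psum n (x : n.-tuple nat) (k : nat) : nat :=
  \sum_(1 <= i < k.+1) entry x i.

Definition max_coord n (x : n.-tuple nat) : nat := \max_(i < n) tnth x i.

Definition nonincreasing n (x : n.-tuple nat) : bool := sorted geq x.

Definition dominated n (x y : n.-tuple nat) : bool :=
  [forall k : 'I_n, psum x k.+1 <= psum y k.+1].

(* An irreflexive relation is a simple loopless digraph; e i j is the edge
   from i to j. *)
Definition digraphic n (a b : n.-tuple nat) : Prop :=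
  exists e : rel 'I_n,
    [/\ irreflexive e,
        forall i, #|[set j | e i j]| = tnth a i
      & forall j, #|[set i | e i j]| = tnth b j].

Definition conjugate n (c : n.-tuple nat) (k : nat) : nat :=
  #|[set i : 'I_n | k <= tnth c i]|.

(* Elements of {0,1}^(n x n) are boolean matrices, with the coercion from
   bool to nat used in the sums. *)
Definition row_sum n (A : 'M[bool]_n) (i : 'I_n) : nat := \sum_(j < n) A i j.

Definition col_sums n (A : 'M[bool]_n) : n.-tuple nat :=
  [tuple \sum_(i < n) A i j | j < n].

Definition mx_dominated n (A B : 'M[bool]_n) : bool :=
  dominated (col_sums A) (col_sums B).

(* mx_dominated is only a preorder on matrices, hence this form of
   maximality. *)
Definition maximal_elements n (S : {set 'M[bool]_n}) : {set 'M[bool]_n} :=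
  [set A in S | [forall B in S, mx_dominated A B ==> mx_dominated B A]].

(* The value is the zero vector, a junk value, when S does not have a unique
   maximal element. *)
Definition generalized_conjugate n (S : {set 'M[bool]_n}) : n.-tuple nat :=
  if [pick A | maximal_elements S == [set A]] is Some A then col_sums A
  else [tuple 0 | _ < n].

Definition zero_diag_matrices n (b : n.-tuple nat) : {set 'M[bool]_n} :=
  [set A : 'M[bool]_n |
    [forall i, row_sum A i == tnth b i] && [forall i, ~~ A i i]].

(* The vector usually written b^{0,I}. *)
Definition conj0I n (b : n.-tuple nat) : n.-tuple nat :=
  generalized_conjugate (zero_diag_matrices b).

(* Meant for 1 <= k <= n; then k.-1 is exactly k - 1. *)
Definition fulkerson n (a b : n.-tuple nat) (k : nat) : Prop :=
  \sum_(1 <= i < k.+1) entry a i <=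
    \sum_(1 <= i < k.+1) minn k.-1 (entry b i)
    + \sum_(k.+1 <= i < n.+1) minn k (entry b i).

Definition corner (x : nat -> nat) (k : nat) : bool :=
  (1 <= k) && (x k.+1 < x k).

(* The infinite sum of a'_i over i > j stops at i = max a, since a'_i = 0
   beyond it. The truncated subtraction is exact whenever a'_j >= 1, hence at
   every corner j of a'. *)
Definition conjugate_ineq n (a b : n.-tuple nat) (j : nat) : Prop :=
  let a' := conjugate a in
  let b' := conjugate b in
  j * a' j + \sum_(j.+1 <= i < (max_coord a).+1) a' i <=
    \sum_(1 <= i < (a' j).+1) b' i - minn (a' j) (b' (a' j)).

(* Main.v *)
(* The right-hand sides of (F_k) are the partial sums of the column sums c of
   the matrix whose rows are filled from the left, skipping the diagonal; row
   by row this matrix dominates all others, so c is b^{0,I}. Conversely, among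
   the matrices whose column sums y dominate a, take one for which the partial
   sums of y have the least total. If y_q < a_q, let p be the last index before q with
   a_p < y_p. Then y_p >= y_q + 2 because a is nonincreasing, so some row other than q has a 1
   in column p and a 0 in column q, and moving this 1 from p to q contradicts
   minimality: the diagonal can spoil only one row, which is why no order on b
   is needed. For the restriction to corners, c is nonincreasing up to an
   error of 1, so a violated inequality stays violated as long as a remains
   constant. Finally (5) at j is (F_k) at the corner k = a'_j of a. *)
Require Import Defs.
From mathcomp Require Import all_boot matrix zify.

Set Implicit Arguments.
Unset Strict Implicit.
Unset Printing Implicit Defensive.

(** * Partial sums and coordinates of tuples, indexed from 0 *)

Lemma psumE n (x : n.-tuple nat) k : psum x k = \sum_(i < k) nth 0 x i.
Proof. by rewrite /psum big_add1 big_mkord. Qed.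

Lemma sum_tnthE n (x : n.-tuple nat) :
  \sum_(i < n) tnth x i = \sum_(i < n) nth 0 x i.
Proof. by apply: eq_bigr => i _; rewrite (tnth_nth 0). Qed.

Lemma nth_le_max n (x : n.-tuple nat) i : nth 0 x i <= max_coord x.
Proof.
case: (ltnP i n) => [lt_in | le_ni]; last by rewrite nth_default ?size_tuple.
by rewrite -(tnth_nth 0 x (Ordinal lt_in)); apply: leq_bigmax.
Qed.

Lemma nonincreasing_nth n (x : n.-tuple nat) i j :
  nonincreasing x -> i <= j -> nth 0 x j <= nth 0 x i.
Proof.
move=> sx le_ij; case: (ltnP j n) => [lt_jn | le_nj]; last first.
  by rewrite nth_default ?size_tuple.
have tr : transitive geq by move=> u v w /= ? ?; lia.
by apply: (sorted_leq_nth tr (fun u => leqnn u) 0 sx) => //;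
  rewrite inE size_tuple //; lia.
Qed.

(** * Left-justified fillings and the right-hand side of (F_k) *)

(* The number of ones among the first k cells of row i of a left-justified
   off-diagonal filling with m ones. *)
Definition fill_prefix i m k := minn (k - (i < k)) m.

(** [j - (i < j)] is the rank of cell [j], counted from 0, among the off-diagonal cells of row
    [i]. *)
Definition fill i m j := (j != i) && (j - (i < j) < m).

(** Right-hand side of (F_k) in one sum: for [i < k] the diagonal cell is among the first [k], which
    leaves the [k - 1] of the minimum. *)
Definition fulkerson_bound n (b : n.-tuple nat) k :=
  \sum_(i < n) fill_prefix i (nth 0 b i) k.

Lemma sum_fill i m k : \sum_(j < k) fill i m j = fill_prefix i m k.
Proof.
elim: k => [|k IHk]; first by rewrite big_ord0 /fill_prefix sub0n min0n.
by rewrite big_ord_recr /= IHk /fill_prefix /fill; lia.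
Qed.

Lemma sum_neq i k : \sum_(j < k) (j != i :> nat) = k - (i < k).
Proof.
(* With [k] ones the filling occupies every off-diagonal cell among the first [k]. *)
rewrite (eq_bigr (fun j : 'I_k => fill i k j : nat)).
  by rewrite sum_fill /fill_prefix; lia.
by move=> j _; have := ltn_ord j; rewrite /fill; lia.
Qed.

Lemma fulkersonE n (a b : n.-tuple nat) k : 0 < k <= n ->
  fulkerson a b k <-> psum a k <= fulkerson_bound b k.
Proof.
move=> /andP[k_gt0 le_kn]; rewrite /fulkerson -/(psum a k).
suff -> : fulkerson_bound b k =
  \sum_(1 <= i < k.+1) minn k.-1 (entry b i)
  + \sum_(k.+1 <= i < n.+1) minn k (entry b i) by [].
rewrite /fulkerson_bound -(big_mkord predT (fun i => fill_prefix i (nth 0 b i) k)).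
rewrite (big_cat_nat (leq0n k) le_kn) //= !big_add1 /=.
by congr addn; apply: eq_big_nat => i; rewrite /fill_prefix /entry /=; lia.
Qed.

(** Each row has at least [k - 1] off-diagonal cells among its first [k], enough for all its
    ones. *)
Lemma fulkerson_bound_max n (b : n.-tuple nat) k :
  max_coord b < k -> k <= n -> fulkerson_bound b k = \sum_(i < n) nth 0 b i.
Proof.
move=> lt_bk le_kn; apply: eq_bigr => i _.
by have := nth_le_max b i; rewrite /fill_prefix; lia.
Qed.

Lemma fulkerson_bound_n n (b : n.-tuple nat) :
  max_coord b <= n.-1 -> fulkerson_bound b n = \sum_(i < n) nth 0 b i.
Proof.
move=> hb; apply: eq_bigr => i _.
by have := nth_le_max b i; rewrite /fill_prefix ltn_ord; lia.
Qed.

Definition fill_col n (b : n.-tuple nat) k := \sum_(i < n) fill i (nth 0 b i) k.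

Lemma sum_fill_col n (b : n.-tuple nat) k :
  \sum_(j < k) fill_col b j = fulkerson_bound b k.
Proof. by rewrite exchange_big; apply: eq_bigr => i _; rewrite sum_fill. Qed.

(** A row that reaches column [m] has also filled the earlier column [k], unless its diagonal cell
    lies there; only row [k] is such an exception. *)
Lemma fill_col_leS n (b : n.-tuple nat) k m :
  k < m -> fill_col b m <= (fill_col b k).+1.
Proof.
move=> lt_km; have H i : fill i (nth 0 b i) m <= fill i (nth 0 b i) k + (i == k).
  by rewrite /fill; lia.
apply: (leq_trans (leq_sum _ (fun (i : 'I_n) _ => H i))).
rewrite big_split /= -addn1 leq_add2l.
case: (ltnP k n) => [lt_kn | le_nk].
  by rewrite (bigD1 (Ordinal lt_kn)) //= eqxx big1 // => i; rewrite -val_eqE => /negbTE->.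
by rewrite big1 // => i _; have := ltn_ord i; lia.
Qed.

(** * Prefix sums of sequences: corners, excesses and deficits *)

(** If the inequality breaks in passing from [k] to [k.+1], then [c k < a k], so every later [c m]
    is at most [a k] and the failure lasts while [a] is constant. A drop of [a] would be a corner,
    where the inequality is assumed; hence the failure reaches [n], against the totals. *)
Lemma leq_sum_corners n (a c : nat -> nat) :
  (forall k m, k < m -> c m <= (c k).+1) ->
  (forall k, a k.+1 <= a k) ->
  \sum_(i < n) a i <= \sum_(i < n) c i ->
  (forall k, k < n -> a k.+1 < a k ->
    \sum_(i < k.+1) a i <= \sum_(i < k.+1) c i) ->
  forall k, k <= n -> \sum_(i < k) a i <= \sum_(i < k) c i.
Proof.
move=> hc ha hn hcorner; elim=> [|k IHk] lt_kn; first by rewrite !big_ord0.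
have {}IHk := IHk (ltnW lt_kn).
rewrite leqNgt; apply/negP => fail_k.
have lt_ca : c k < a k.
  rewrite ltnNge; apply: contraL fail_k => le_ac.
  by rewrite -leqNgt !big_ord_recr leq_add.
have stay m : k + m < n -> a (k + m) = a k /\
    \sum_(i < (k + m).+1) c i < \sum_(i < (k + m).+1) a i.
  elim: m => [|m IHm] lt_n; first by rewrite addn0.
  have [eq_a fail_m] : a (k + m) = a k /\
    \sum_(i < (k + m).+1) c i < \sum_(i < (k + m).+1) a i by apply: IHm; lia.
  have eq_aS : a (k + m.+1) = a k.
    apply/eqP; rewrite addnS -eq_a eqn_leq ha leqNgt.
    have lt_kmn : k + m < n by lia.
    by apply/negP => /(hcorner _ lt_kmn); rewrite leqNgt fail_m.
  split=> //; rewrite big_ord_recr [X in _ < X]big_ord_recr /= eq_aS.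
  rewrite -addSn leq_add ?addnS // (leq_trans _ lt_ca) // hc //.
  by rewrite ltnS leq_addr.
have [|_] := stay (n - k.+1); first by lia.
by rewrite -addSn subnKC // ltnNge hn.
Qed.

Lemma excess_before_deficit n (a y : nat -> nat) :
  (forall k, k <= n -> \sum_(i < k) a i <= \sum_(i < k) y i) ->
  \sum_(i < n) a i = \sum_(i < n) y i ->
  (exists i : 'I_n, a i != y i) ->
  exists p q, [/\ p < q < n, a p < y p, y q < a q &
    forall k, p < k <= q -> \sum_(i < k) a i < \sum_(i < k) y i].
Proof.
move=> dom tot [i0 neq].
have [q lt_q] : exists q : 'I_n, y q < a q.
  apply/existsP; apply: contraNT neq => /existsPn le_ay.
  (* If [a] is at most [y] everywhere, equal totals force equality at each index. *)
  have le i : true -> a (i : 'I_n) <= y i ?= iff (a i == y i).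
    by move=> _; split=> //; rewrite leqNgt le_ay.
  by have [_] := leqif_sum le; rewrite tot eqxx => /esym/forallP/(_ i0).
have lt_sum : \sum_(i < q) a i < \sum_(i < q) y i.
  by have := dom q.+1 (ltn_ord q); rewrite !big_ord_recr /=; lia.
have [q' q'E] : {q' | q' = nat_of_ord q} by exists q.
have lt_qn := ltn_ord q; rewrite -q'E in lt_q lt_sum lt_qn.
suff [p [lt_pq lt_p hp]] : exists p, [/\ p < q', a p < y p &
    forall k, p < k <= q' -> \sum_(i < k) a i < \sum_(i < k) y i].
  by exists p, q'; rewrite lt_pq lt_qn.
(* Descent from [q]: while [y m <= a m], the strict inequality passes to the shorter prefix; the
   empty prefix cannot satisfy it, so an excess is met on the way. *)
elim: q' {lt_q q'E lt_qn} lt_sum => [|m IHm] lt_sum.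
  by rewrite !big_ord0 in lt_sum.
case: (ltnP (a m) (y m)) => [lt_m | le_m].
  exists m; split=> // k lt_k; have -> : k = m.+1 by lia.
  exact: lt_sum.
have [|p [lt_p lt_ay hp]] := IHm.
  by move: lt_sum; rewrite !big_ord_recr /=; lia.
exists p; split=> // [|k /andP[lt_pk]]; first exact: ltnW.
by rewrite leq_eqVlt => /orP[/eqP-> // | le_km]; apply: hp; rewrite lt_pk.
Qed.

(** * Zero-diagonal matrices and their maximal element *)

Lemma zero_diagP n (b : n.-tuple nat) (A : 'M[bool]_n) :
  reflect ((forall i, \sum_(j < n) A i j = nth 0 b i) /\ (forall i, A i i = false))
    (A \in zero_diag_matrices b).
Proof.
rewrite inE; apply: (iffP andP) => [] [rows diag]; split.
- by move=> i; have /eqP := forallP rows i; rewrite (tnth_nth 0).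
- by move=> i; apply/negbTE/(forallP diag).
- by apply/forallP => i; rewrite (tnth_nth 0) /row_sum rows.
- by apply/forallP => i; rewrite diag.
Qed.

Lemma nth_col_sums n (A : 'M[bool]_n) (j : 'I_n) :
  nth 0 (col_sums A) j = \sum_(i < n) A i j.
Proof. by rewrite -tnth_nth tnth_mktuple. Qed.

Lemma psum_ord n (x : n.-tuple nat) k : k <= n ->
  psum x k = \sum_(i < n | i < k) nth 0 x i.
Proof. by move=> le_kn; rewrite psumE (big_ord_widen n (nth 0 x)). Qed.

Lemma psum_col_sums n (A : 'M[bool]_n) k : k <= n ->
  psum (col_sums A) k = \sum_(i < n) \sum_(j < n | j < k) A i j.
Proof.
move=> le_kn; rewrite psum_ord // exchange_big.
by apply: eq_bigr => j _; rewrite nth_col_sums.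
Qed.

Lemma dominatedP n (x y : n.-tuple nat) :
  reflect (forall k, k <= n -> psum x k <= psum y k) (dominated x y).
Proof.
apply: (iffP forallP) => [H [|k] lt_kn | H k]; last exact: H.
  by rewrite !psumE !big_ord0.
exact: (H (Ordinal lt_kn)).
Qed.

Lemma row_prefix_le n (b : n.-tuple nat) (A : 'M[bool]_n) i k :
    A \in zero_diag_matrices b -> k <= n ->
  \sum_(j < n | j < k) A i j <= fill_prefix i (nth 0 b i) k.
Proof.
move=> /zero_diagP[rows diag] le_kn; rewrite leq_min; apply/andP; split.
  rewrite -sum_neq (big_ord_widen n (fun j => (j != i :> nat) : nat)) //.
  apply: leq_sum => j _; case: (eqVneq (j : nat) i) => [/val_inj->|_].
    by rewrite diag.
  exact: leq_b1.
by rewrite -rows [leqRHS](bigID (fun j : 'I_n => j < k)) leq_addr.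
Qed.

Lemma psum_col_sums_le n (b : n.-tuple nat) (A : 'M[bool]_n) k :
    A \in zero_diag_matrices b -> k <= n ->
  psum (col_sums A) k <= fulkerson_bound b k.
Proof.
move=> bA le_kn; rewrite psum_col_sums //.
by apply: leq_sum => i _; apply: row_prefix_le.
Qed.

Definition fill_mx n (b : n.-tuple nat) : 'M[bool]_n :=
  \matrix_(i, j) fill i (nth 0 b i) j.

Lemma fill_mx_prefix n (b : n.-tuple nat) i k : k <= n ->
  \sum_(j < n | j < k) fill_mx b i j = fill_prefix i (nth 0 b i) k.
Proof.
move=> le_kn; rewrite -sum_fill.
rewrite (big_ord_widen n (fun j => fill i (nth 0 b i) j : nat)) //.
by apply: eq_bigr => j _; rewrite mxE.
Qed.

Lemma psum_fill_mx n (b : n.-tuple nat) k : k <= n ->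
  psum (col_sums (fill_mx b)) k = fulkerson_bound b k.
Proof.
move=> le_kn; rewrite psum_col_sums //.
by apply: eq_bigr => i _; rewrite fill_mx_prefix.
Qed.

Lemma fill_mx_zero_diag n (b : n.-tuple nat) :
  max_coord b <= n.-1 -> fill_mx b \in zero_diag_matrices b.
Proof.
move=> hb; apply/zero_diagP; split=> i; last by rewrite mxE /fill eqxx.
transitivity (\sum_(j < n | j < n) fill_mx b i j).
  by apply: eq_bigl => j; rewrite ltn_ord.
rewrite fill_mx_prefix // /fill_prefix ltn_ord.
by have := nth_le_max b i; lia.
Qed.

(** Each entry is the difference of two consecutive prefix sums of its row. *)
Lemma row_prefix_inj n (A B : 'M[bool]_n) :
  (forall i k, k <= n -> \sum_(j < n | j < k) A i j = \sum_(j < n | j < k) B i j) ->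
  A = B.
Proof.
move=> eqAB; apply/matrixP => i j.
have split_at (M : 'M[bool]_n) : \sum_(j' < n | j' < j.+1) M i j' =
    M i j + \sum_(j' < n | j' < j) M i j'.
  rewrite (bigD1 j) //=; congr addn; apply: eq_bigl => j'.
  by rewrite -val_eqE /=; lia.
move: (eqAB i j.+1 (ltn_ord j)); rewrite !split_at (eqAB i j (ltnW (ltn_ord j))).
by move/addIn; case: (A i j); case: (B i j).
Qed.

(** A maximal [A] has the same partial column sums as [fill_mx b]. These are sums over rows of
    prefixes bounded by those of [fill_mx b], so equality holds row by row and determines [A]. *)
Lemma maximal_fill_mx n (b : n.-tuple nat) : max_coord b <= n.-1 ->
  maximal_elements (zero_diag_matrices b) = [set fill_mx b].
Proof.
move=> hb; have Gb := fill_mx_zero_diag hb.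
have domG A : A \in zero_diag_matrices b -> mx_dominated A (fill_mx b).
  by move=> bA; apply/dominatedP => k le_kn; rewrite psum_fill_mx ?psum_col_sums_le.
apply/setP => A; rewrite in_set1 in_set.
apply/andP/eqP => [[bA /forallP/(_ (fill_mx b))] | ->]; last first.
  by split=> //; apply/forallP => B; apply/implyP => bB; rewrite domG ?implybT.
rewrite Gb domG //= => /dominatedP domA.
apply: row_prefix_inj => i k le_kn; rewrite fill_mx_prefix //.
have le r : true -> \sum_(j < n | j < k) A (r : 'I_n) j
    <= fill_prefix r (nth 0 b r) k
    ?= iff (\sum_(j < n | j < k) A r j == fill_prefix r (nth 0 b r) k).
  by move=> _; split=> //; apply: row_prefix_le.
have [_] := leqif_sum le; rewrite -psum_col_sums // eqn_leq.
rewrite psum_col_sums_le // -/(fulkerson_bound b k) -psum_fill_mx // domA //.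
by move/esym/forallP/(_ i)/eqP.
Qed.

Lemma conj0IE n (b : n.-tuple nat) : max_coord b <= n.-1 ->
  conj0I b = col_sums (fill_mx b).
Proof.
move=> hb; rewrite /conj0I /generalized_conjugate maximal_fill_mx //.
case: pickP => [A /eqP/set1_inj-> // | /(_ (fill_mx b))].
by rewrite eqxx.
Qed.

(** * Digraphs as matrices and the exchange argument *)

Lemma digraphicP n (a b : n.-tuple nat) :
  digraphic a b <-> exists2 A, A \in zero_diag_matrices b & col_sums A = a.
Proof.
split=> [[e [irr outd ind]] | [A /zero_diagP[rows diag] cols]].
  (* The adjacency matrix is transposed, because the rows must sum to the in-degrees [b]. *)
  exists (\matrix_(i, j) e j i)%R.
    apply/zero_diagP; split=> i; last by rewrite mxE irr.
    rewrite -(tnth_nth 0) -ind -sum1dep_card [RHS]big_mkcond /=.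
    by apply: eq_bigr => j _; rewrite mxE; case: (e j i).
  apply: eq_from_tnth => j; rewrite tnth_mktuple -outd -sum1dep_card [RHS]big_mkcond.
  by apply: eq_bigr => i _; rewrite mxE; case: (e j i).
exists (fun i j => A j i); split=> [i | j | i]; first exact: diag.
  rewrite -cols tnth_mktuple -sum1dep_card [LHS]big_mkcond.
  by apply: eq_bigr => i _; case: (A i j).
rewrite (tnth_nth 0) -rows -sum1dep_card [LHS]big_mkcond.
by apply: eq_bigr => j _; case: (A i j).
Qed.

Lemma move_one n (b : n.-tuple nat) (A : 'M[bool]_n) (p q : 'I_n) :
    A \in zero_diag_matrices b ->
    (\sum_(i < n) A i q).+1 < \sum_(i < n) A i p ->
  exists2 B, B \in zero_diag_matrices b & forall k, k <= n ->
    psum (col_sums B) k + (p < k) = psum (col_sums A) k + (q < k).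
Proof.
move=> /zero_diagP[rows diag] lt_qp.
(* Without such a row, column [p] would be at most column [q] outside row [q], and row [q] adds at
   most 1. *)
have [r /and3P[neq_rq Arp nArq]] : exists r, [&& r != q, A r p & ~~ A r q].
  apply/existsP; apply: contraTT lt_qp => /existsPn none; rewrite -leqNgt.
  rewrite -addn1 (bigD1 q) //= [X in _ <= X + 1](bigD1 q) //= diag add0n addnC.
  rewrite leq_add ?leq_b1 //; apply: leq_sum => i neq_iq.
  by move: (none i); rewrite neq_iq; case: (A i p); case: (A i q).
have neq_pq : p != q by apply: contraNneq nArq => <-.
have neq_rp : r != p by apply: contraTneq Arp => <-; rewrite diag.
pose B : 'M[bool]_n := (\matrix_(i, j)
  if i == r then (j != p) && ((j == q) || A i j) else A i j)%R.
(* The move is written additively on both sides, which avoids truncated subtraction when it is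
   summed. *)
have cell i j : B i j + ((i == r) && (j == p)) = A i j + ((i == r) && (j == q)).
  rewrite mxE; case: eqVneq => [->|]; last by rewrite !addn0.
  case: (eqVneq j p) => [->|_]; first by rewrite (negbTE neq_pq) Arp.
  by case: eqVneq => [->|_]; rewrite ?(negbTE nArq) ?addn0.
have sum_eq (P : pred 'I_n) j : \sum_(i < n | P i) (i == j) = P j.
  rewrite big_mkcond (bigD1 j) //= eqxx big1 ?addn0; first by case: (P j).
  by move=> i /negbTE->; case: (P i).
have sum_row (P : pred 'I_n) i :
    \sum_(j < n | P j) B i j + ((i == r) && P p) =
    \sum_(j < n | P j) A i j + ((i == r) && P q).
  have sum_and j : \sum_(j' < n | P j') ((i == r) && (j' == j))
      = ((i == r) && P j).
    by case: (i == r) => /=; rewrite ?sum_eq // big1.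
  rewrite -!sum_and -!big_split /=.
  by apply: eq_bigr => j _; rewrite cell.
exists B.
  apply/zero_diagP; split=> i; first by rewrite -rows; apply: addIn (sum_row predT i).
  rewrite mxE; case: eqVneq => [->|_]; last exact: diag.
  by rewrite (negbTE neq_rq) diag andbF.
move=> k le_kn; rewrite !psum_col_sums //.
have sum_and (c : bool) : \sum_(i < n) ((i == r) && c) = c.
  by rewrite -[RHS](sum_eq (fun=> c) r) [RHS]big_mkcond; apply: eq_bigr => i _;
    rewrite andbC; case: c.
rewrite -(sum_and (p < k)) -[in RHS](sum_and (q < k)) -!big_split.
by apply: eq_bigr => i _; apply: sum_row.
Qed.

Lemma digraphic_of_bound n (a b : n.-tuple nat) :
    nonincreasing a -> max_coord b <= n.-1 ->
    \sum_(i < n) nth 0 a i = \sum_(i < n) nth 0 b i ->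
    (forall k, k <= n -> psum a k <= fulkerson_bound b k) ->
  digraphic a b.
Proof.
move=> ha hb hab bound; apply/digraphicP.
pose P A := (A \in zero_diag_matrices b) && dominated a (col_sums A).
have PG : P (fill_mx b).
  rewrite /P fill_mx_zero_diag //; apply/dominatedP => k le_kn.
  by rewrite psum_fill_mx ?bound.
pose weight (A : 'M[bool]_n) := \sum_(k < n.+1) psum (col_sums A) k.
case: (arg_minnP weight PG) => A /andP[bA /dominatedP domA] minA.
exists A => //; apply: eq_from_tnth => i0; apply/eqP/contraT => neq.
have [|||p [q [/andP[lt_pq lt_qn] ltp ltq between]]] :=
    @excess_before_deficit n (nth 0 a) (nth 0 (col_sums A)).
- by move=> k /domA; rewrite !psumE.
(* Equal totals: domination gives one inequality, the bound at [n], equal to the total of [b], the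
   other. *)
- apply/eqP; rewrite eqn_leq -!psumE domA //=.
  rewrite [leqRHS]psumE hab -(fulkerson_bound_n hb).
  exact: psum_col_sums_le.
- by exists i0; rewrite -!tnth_nth eq_sym.
have lt_pn := ltn_trans lt_pq lt_qn.
have [|B bB eqB] := @move_one n b A (Ordinal lt_pn) (Ordinal lt_qn) bA.
  rewrite -!nth_col_sums (leq_ltn_trans _ ltp) //.
  exact: leq_trans ltq (nonincreasing_nth ha (ltnW lt_pq)).
(* The move lowers prefix sums by one exactly for [p < k <= q], where they strictly exceed those of
   [a]. *)
have PB : P B.
  rewrite /P bB; apply/dominatedP => k le_kn.
  have := domA k le_kn; have := eqB k le_kn; have := between k.
  by rewrite -!psumE /=; lia.
suff : weight B < weight A by rewrite ltnNge minA.
have le k : k <= n -> psum (col_sums B) k <= psum (col_sums A) k.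
  by move=> /eqB /=; lia.
(* The term [k = q] drops strictly: that prefix contains column [p] but not column [q]. *)
rewrite /weight (bigD1 (Ordinal (ltnW lt_qn : q < n.+1))) //=.
rewrite [X in _ < X](bigD1 (Ordinal (ltnW lt_qn : q < n.+1))) //= -addSn.
apply: leq_add; first by have := eqB q (ltnW lt_qn); rewrite /= lt_pq ltnn; lia.
by apply: leq_sum => k _; apply: le; rewrite -ltnS.
Qed.

(** * Restriction to corners *)

Lemma bound_of_corners n (a b : n.-tuple nat) :
    nonincreasing a -> max_coord b <= n.-1 ->
    \sum_(i < n) nth 0 a i = \sum_(i < n) nth 0 b i ->
    (forall k, 1 <= k <= n -> corner (entry a) k -> k <= max_coord b ->
      fulkerson a b k) ->
  forall k, k <= n -> psum a k <= fulkerson_bound b k.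
Proof.
move=> ha hb hab corners k; rewrite psumE -sum_fill_col.
apply: leq_sum_corners k => [k m|k||k lt_kn lt_a].
- exact: fill_col_leS.
- exact: nonincreasing_nth.
- by rewrite sum_fill_col hab fulkerson_bound_n.
rewrite sum_fill_col -psumE; case: (leqP k.+1 (max_coord b)) => [le_kb | lt_bk].
  by apply/fulkersonE => //; apply: corners.
(* Past [max_coord b] the bound is the total of [b], which is that of [a]. *)
rewrite fulkerson_bound_max // -hab psum_ord //.
by rewrite [leqRHS](bigID (fun i : 'I_n => i < k.+1)) leq_addr.
Qed.

(** * Conjugates and condition (5) *)

Lemma conjugateE n (c : n.-tuple nat) m :
  conjugate c m = \sum_(i < n) (m <= nth 0 c i).
Proof.
rewrite /conjugate -sum1dep_card big_mkcond.
by apply: eq_bigr => i _; rewrite (tnth_nth 0); case: (m <= _).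
Qed.

Lemma conjugate_le n (c : n.-tuple nat) m : conjugate c m <= n.
Proof. by rewrite /conjugate -[leqRHS]card_ord max_card. Qed.

(** For nonincreasing [c] the indices with entry at least [m] form an initial segment, whose length
    is the conjugate. *)
Lemma leq_nth_conjugate n (c : n.-tuple nat) m i :
  nonincreasing c -> i < n -> (m <= nth 0 c i) = (i < conjugate c m).
Proof.
move=> sc lt_in.
have sum_lt k : k <= n -> \sum_(j < n) (j < k) = k.
  move=> le_kn; rewrite -[RHS]card_ord -sum1_card (big_ord_widen n (fun=> 1)) //.
  by rewrite [RHS]big_mkcond; apply: eq_bigr => j _; case: (j < k).
rewrite conjugateE; apply/idP/idP => [le_m | ].
  rewrite -[i.+1]sum_lt //; apply: leq_sum => j _.
  case: (ltnP j i.+1) => //= le_ji.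
  by rewrite (leq_trans le_m) //; apply: nonincreasing_nth.
apply: contraTT; rewrite -!ltnNge ltnS => lt_m.
rewrite -[leqRHS](sum_lt i (ltnW lt_in)); apply: leq_sum => j _.
case: (ltnP j i) => /= [_|le_ij]; first exact: leq_b1.
by rewrite [m <= _]leqNgt (leq_ltn_trans _ lt_m) //; apply: nonincreasing_nth.
Qed.

Lemma sum_leq_between x j m : \sum_(j.+1 <= i < m.+1) (i <= x) = minn m x - j.
Proof.
elim: m => [|m IHm]; first by rewrite big_geq // min0n.
case: (leqP j m) => [le_jm | lt_mj].
  by rewrite big_nat_recr //= IHm; lia.
by rewrite big_geq //; lia.
Qed.

Lemma sum_conjugate n (c : n.-tuple nat) j m :
  \sum_(j.+1 <= i < m.+1) conjugate c i = \sum_(i < n) (minn m (nth 0 c i) - j).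
Proof.
rewrite (eq_bigr _ (fun i _ => conjugateE c i)) exchange_big.
by apply: eq_bigr => i _; rewrite sum_leq_between.
Qed.

Lemma conjugate_ineqE n (a b : n.-tuple nat) j :
    nonincreasing a -> nonincreasing b -> 0 < conjugate a j ->
  conjugate_ineq a b j <-> fulkerson a b (conjugate a j).
Proof.
move=> ha hb; set k := conjugate a j => k_gt0.
have le_kn : k <= n by apply: conjugate_le.
suff lhs : j * k + \sum_(j.+1 <= i < (max_coord a).+1) conjugate a i = psum a k.
  suff rhs : \sum_(1 <= i < k.+1) conjugate b i - minn k (conjugate b k)
      = fulkerson_bound b k.
    rewrite /conjugate_ineq -/k lhs rhs.
    by apply: iff_sym; apply: fulkersonE; rewrite k_gt0.
  (* The subtracted minimum counts the rows [i < k] with [b_i >= k], exactly those where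
     [min(k - 1, b_i)] is one less than [min(k, b_i)]. *)
  suff -> : minn k (conjugate b k) = \sum_(i < n) ((i < k) && (k <= nth 0 b i)).
    rewrite sum_conjugate -sumnB => [|i _]; last by lia.
    by apply: eq_bigr => i _; rewrite /fill_prefix; lia.
  have le_mn : minn k (conjugate b k) <= n by rewrite geq_min le_kn.
  rewrite -[LHS]card_ord -sum1_card (big_ord_widen n (fun=> 1) le_mn) big_mkcond.
  apply: eq_bigr => i _; rewrite leq_nth_conjugate // leq_min.
  by case: (_ && _).
(* The first [k] rows have [a_i >= j] and contribute [j + (a_i - j)]; the others contribute 0. *)
rewrite sum_conjugate psum_ord // [RHS]big_mkcond.
rewrite {1}/k conjugateE big_distrr -big_split.
apply: eq_bigr => i _ /=; rewrite -leq_nth_conjugate //.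
by have := nth_le_max a i; case: (leqP j); lia.
Qed.

Lemma corner_of_conjugate n (a : n.-tuple nat) j : nonincreasing a ->
  corner (conjugate a) j -> corner (entry a) (conjugate a j).
Proof.
move=> ha /andP[j_gt0 lt_conj]; rewrite /corner; set k := conjugate a j.
have le_kn : k <= n by apply: conjugate_le.
have k_gt0 : 0 < k by apply: leq_ltn_trans lt_conj.
rewrite k_gt0 /entry -(prednK k_gt0) /=.
(* In numbering from 1, [j] separates the two entries: [a_(k+1) < j <= a_k]. *)
apply: (@leq_trans j); last by rewrite leq_nth_conjugate ?prednK // -/k; lia.
rewrite prednK //; case: (ltnP k n) => [lt_kn | le_nk].
  by rewrite ltnNge leq_nth_conjugate // ltnn.
by rewrite nth_default ?size_tuple.
Qed.

(** With [j = a_k > a_(k+1)], exactly the first [k] entries are at least [j], and fewer are at least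
    [j + 1]. *)
Lemma conjugate_of_corner n (a : n.-tuple nat) k : nonincreasing a ->
    k <= n -> corner (entry a) k ->
  conjugate a (entry a k) = k /\ corner (conjugate a) (entry a k).
Proof.
move=> ha le_kn /andP[]; case: k le_kn => // k lt_kn _.
rewrite /entry /= => lt_a; set j := nth 0 a k.
have conj_j : conjugate a j = k.+1.
  apply/eqP; rewrite eqn_leq -leq_nth_conjugate // leqnn andbT.
  case: (ltnP k.+1 n) => [lt_Skn | le_nSk].
    by rewrite leqNgt -leq_nth_conjugate // -ltnNge.
  exact: leq_trans (conjugate_le a j) le_nSk.
split=> //; rewrite /corner conj_j (leq_ltn_trans _ lt_a) //= ltnS.
by rewrite leqNgt -leq_nth_conjugate // -/j ltnn.
Qed.

Theorem theorem3p8 (n : nat) (a b : n.-tuple nat)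
    (ha : nonincreasing a)
    (hb : max_coord b <= n.-1)
    (hab : \sum_(i < n) tnth a i = \sum_(i < n) tnth b i) :
  [<-> digraphic a b;
       dominated a (conj0I b);
       forall k, 1 <= k <= n -> fulkerson a b k;
       forall k, 1 <= k <= n -> corner (entry a) k -> k <= max_coord b ->
         fulkerson a b k]
  /\
  (nonincreasing b ->
    (digraphic a b <->
     forall j, corner (conjugate a) j -> conjugate a j <= max_coord b ->
       conjugate_ineq a b j)).
Proof.
rewrite !sum_tnthE in hab.
have equiv : [<-> digraphic a b;
       dominated a (conj0I b);
       forall k, 1 <= k <= n -> fulkerson a b k;
       forall k, 1 <= k <= n -> corner (entry a) k -> k <= max_coord b ->
         fulkerson a b k].
  tfae.
  - move=> /digraphicP[A bA <-]; apply/dominatedP => k le_kn.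
    by rewrite conj0IE // psum_fill_mx // psum_col_sums_le.
  - rewrite conj0IE // => /dominatedP dom k /[dup] /andP[_ le_kn] hk.
    by apply/fulkersonE => //; rewrite -psum_fill_mx // dom.
  - by move=> hF k hk _ _; apply: hF.
  - by move=> corners; apply: digraphic_of_bound => //; apply: bound_of_corners.
(* Condition (5) is compared with (4): [j] goes to the corner [a'_j] of [a], and every corner [k] of
   [a] arises from [j = a_k]. *)
split=> // nb; apply: (iff_trans (equiv 0 3)); split=> /= [hF j cj le_jb | hC k].
  have /andP[k_gt0 _] := corner_of_conjugate ha cj.
  apply/conjugate_ineqE => //; apply: hF => //; last exact: corner_of_conjugate.
  by rewrite k_gt0 conjugate_le.
move=> /andP[k_gt0 le_kn] ck le_kb.
have [conj_k cj] := conjugate_of_corner ha le_kn ck.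
rewrite -conj_k; apply/conjugate_ineqE; rewrite ?conj_k //.
by apply: hC; rewrite ?conj_k.
Qed.
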